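(* There does not exist any equivariant Borel right-inverse to $\bar\partial$ on $C^\infty_1(\mathbb{C},\mathbb{C})$; that is, there is no Borel $\mathbb{C}$-equivariant map $\Psi:C^\infty_1(\mathbb{C},\mathbb{C})\to C^\infty(\mathbb{C},\mathbb{C})$ such that $\bar\partial(\Psi(g))=g$ for all $g\in C^\infty_1(\mathbb{C},\mathbb{C})$.
   Context: $C^\infty(\mathbb{C},\mathbb{C})$ is the space of smooth (in the real sense) complex-valued functions on $\mathbb{C}$, with its usual Fréchet topology of locally uniform convergence of all partial derivatives and the corresponding Borel $\sigma$-algebra. $\bar\partial=\frac12\left(\frac{\partial}{\partial x}+\mathrm{i}\frac{\partial}{\partial y}\right)$. The additive group $\mathbb{C}$ acts by argument shifts $(w\cdot f)(z)=f(z+w)$. $C^\infty_1(\mathbb{C},\mathbb{C})$ is the set of $f\in C^\infty(\mathbb{C},\mathbb{C})$ whose stabilizer is discrete and one-dimensional, i.e., of the form $\lambda\mathbb{Z}$ for some non-zero $\lambda\in\mathbb{C}$. *)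

(* Defs.v *)
From HB Require Import structures.
From mathcomp Require Import all_boot all_order all_algebra.
From mathcomp Require Import complex.
From mathcomp Require Import all_classical all_reals all_analysis.

Set Implicit Arguments.
Unset Strict Implicit.
Unset Printing Implicit Defensive.

Import Order.TTheory GRing.Theory Num.Theory.
Import numFieldNormedType.Exports.

Local Open Scope classical_set_scope.
Local Open Scope ring_scope.
Local Open Scope complex_scope.

(* The topology of the complex plane is the one of the modulus; the library
   only provides it on the alias R[i]^o. *)
HB.instance Definition _ (R : realType) := NormedModule.copy R[i] R[i]^o.

Section SmoothFunctions.
Variable R : realType.
Local Notation C := R[i].

Definition dir (b : bool) : C := if b then 'i else 1.

Definition re_along (b : bool) (f : C -> C) (z : C) (t : R) : R :=
  complex.Re (f (z + t%:C * dir b)).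

Definition im_along (b : bool) (f : C -> C) (z : C) (t : R) : R :=
  complex.Im (f (z + t%:C * dir b)).

Definition has_partial (b : bool) (f : C -> C) (z : C) : Prop :=
  derivable (re_along b f z) 0 1 /\ derivable (im_along b f z) 0 1.

(* [partial false] is d/dx and [partial true] is d/dy. *)
Definition partial (b : bool) (f : C -> C) (z : C) : C :=
  derive1 (re_along b f z) 0 +i* derive1 (im_along b f z) 0.

(* [partials [:: b1; ...; bn] f] is the mixed partial d_b1 ... d_bn f. *)
Definition partials (s : seq bool) (f : C -> C) : C -> C := foldr partial f s.

Definition smooth (f : C -> C) : Prop := forall s : seq bool,
  continuous (partials s f) /\ forall b z, has_partial b (partials s f) z.

Definition dbar (f : C -> C) (z : C) : C :=
  2^-1 * (partial false f z + 'i * partial true f z).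

Record Cinf := MkCinf { Cinf_fun :> C -> C; Cinf_smooth : smooth Cinf_fun }.

HB.instance Definition _ := gen_eqMixin Cinf.
HB.instance Definition _ := gen_choiceMixin Cinf.

Definition jet (f : Cinf) :
  prod_topology (fun _ : seq bool => {family compact, C -> C}) :=
  fun s => partials s f.

(* Locally uniform convergence of all partial derivatives. *)
HB.instance Definition _ := Topological.copy Cinf (initial_topology jet).

Lemma partials_translate (w : C) (s : seq bool) (f : C -> C) :
  partials s (fun z => f (z + w)) = (fun z => partials s f (z + w)).
Proof.
elim: s => //= b s ->; apply: funext => z; rewrite /partial.
by congr (derive1 _ 0 +i* derive1 _ 0); apply: funext => t;
   rewrite /re_along /im_along addrAC.
Qed.

Lemma addr_continuous (w : C) : continuous (fun z : C => z + w).
Proof.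
move=> z.
exact: (@cvgD _ C _ (nbhs z) _ id (cst w) z w cvg_id (cvg_cst _)).
Qed.

Lemma smooth_translate (w : C) (f : C -> C) :
  smooth f -> smooth (fun z => f (z + w)).
Proof.
move=> sf s; have [cf df] := sf s; rewrite partials_translate; split => [z|b z].
  exact: (continuous_comp (@addr_continuous w z) (cf (z + w))).
have [dr di] := df b (z + w); split.
  suff -> : re_along b (fun z => partials s f (z + w)) z =
            re_along b (partials s f) (z + w) by [].
  by apply: funext => t; rewrite /re_along addrAC.
suff -> : im_along b (fun z => partials s f (z + w)) z =
          im_along b (partials s f) (z + w) by [].
by apply: funext => t; rewrite /im_along addrAC.
Qed.

Definition translate (w : C) (f : Cinf) : Cinf :=
  MkCinf (smooth_translate w (Cinf_smooth f)).

Definition stabilizer (f : Cinf) : set C := [set w | translate w f = f].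

Definition one_periodic : set Cinf :=
  [set f | exists2 l : C, l != 0 &
           stabilizer f = [set l * m%:~R | m in @setT int]].

(* The library equips the type of elements of a set with the subspace
   topology. *)
Definition Cinf1 : Type := one_periodic.

HB.instance Definition _ := Topological.copy Cinf1 (set_type one_periodic).

Lemma Cinf_eqP (f g : Cinf) : (f : C -> C) = g -> f = g.
Proof.
by case: f g => [f sf] [g sg] /= e; subst g; congr MkCinf; exact: Prop_irrelevance.
Qed.

Lemma translateD (v w : C) (f : Cinf) : translate v (translate w f) = translate (v + w) f.
Proof. by apply: Cinf_eqP; apply: funext => z /=; rewrite addrA. Qed.

Lemma translate0 (f : Cinf) : translate 0 f = f.
Proof. by apply: Cinf_eqP; apply: funext => z /=; rewrite addr0. Qed.

Lemma stabilizer_translate (w : C) (f : Cinf) :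
  stabilizer (translate w f) = stabilizer f.
Proof.
apply/seteqP; split => v; rewrite /stabilizer /= => e.
  have := congr1 (translate (- w)) e.
  by rewrite !translateD addrAC addNr add0r translate0.
by rewrite translateD addrC -translateD e.
Qed.

Lemma one_periodic_translate (w : C) (g : Cinf1) :
  translate w (\val g) \in one_periodic.
Proof.
have /set_mem [l l0 e] := valP g.
by apply/mem_set; exists l => //; rewrite stabilizer_translate.
Qed.

Definition translate1 (w : C) (g : Cinf1) : Cinf1 :=
  exist _ (translate w (\val g)) (one_periodic_translate w g).

End SmoothFunctions.

(* Measurability for the Borel sigma-algebras; the library's [measurable_fun]
   would require a distinguished point in both spaces. *)
Definition borel_map (S T : topologicalType) (f : S -> T) : Prop :=
  forall B : set T, <<s open >> B -> <<s open >> (f @^-1` B).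

(* Main.v *)
Require Import Defs.
From mathcomp Require Import all_boot all_order all_algebra.
From mathcomp Require Import complex.
From mathcomp Require Import all_classical all_reals all_analysis.
From mathcomp Require Import measurable_realfun ring lra.

Set Implicit Arguments.
Unset Strict Implicit.
Unset Printing Implicit Defensive.

Import Order.TTheory GRing.Theory Num.Theory.
Import numFieldNormedType.Exports.

Local Open Scope classical_set_scope.
Local Open Scope ring_scope.

(** If [Psi] commutes with translations and [g] has period [2 pi], then so has
    [f := Psi g].  Averaging [dbar f = g] over a horizontal period kills the
    derivative along the period, so that the zero Fourier mode of [f], as a
    function of the ordinate, is a primitive of the zero mode of [g] (up to a
    constant factor).  An equivariant right inverse of [dbar] would thus choose
    primitives on the line in an equivariant Borel way, and recurrence forbids
    this as soon as the function to be integrated has a nonzero mean.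

    It is enough to defeat [Psi] on the circle of functions
      [g_th (x + i y) = 3 + cos x + cos (pi y) + i cos (y + th)].
    Their stabilizer is exactly [2 pi Z]: the real part is maximal at
    the origin, hence at every period [a + i b], where both cosines must then
    equal one, so that [a] is in [2 pi Z] and [b] in [2 Z]; the imaginary part puts [b] in [2 pi Z], and
    [b = 0] because [pi] is irrational ([stabilizer_witness]).  Moreover
    [g_th (. + 2 i) = g_(th + 2)], so translating by [2 i] only rotates the
    parameter, and [th |-> g_th] is continuous ([continuous_witness1]).

    Let [V th] be the integral of the imaginary part of [Psi g_th] over
    [[0, 2 pi]].  This is a Borel function of [th] with period [2 pi], and
    [V (th + 2) = V th - 24 pi]: the imaginary part [v] and the real part [u]
    of [f] satisfy [v_y = u_x - 2 Re g], where [u_x] has zero integral over a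
    period ([is_derive_average], [average_drift]).  No measurable function
    behaves like this ([no_measurable_drift]): rotations preserve Lebesgue
    measure, and the iterated rotations of the set where [V] is bounded by a
    constant contain infinitely many disjoint sets, so it is a null set. *)

(** * Measurable functions on a circle do not drift *)

Lemma lebesgue_measure_translate (R : realType) (t : R) (A : set R) :
  measurable A ->
  lebesgue_measure ((fun x => x - t) @^-1` A) = lebesgue_measure A :> \bar R.
Proof.
move=> mA.
have mf : measurable_fun [set: R] (fun x : measurableTypeR R => x - t : measurableTypeR R).
  exact: measurable_funB.
pose nu := pushforward (@lebesgue_measure R)
  (fun x : measurableTypeR R => x - t : measurableTypeR R).
have : nu A = lebesgue_measure A.
  apply/esym/lebesgue_measure_unique => //= _ [[a b]] _ <-.
  rewrite /nu /pushforward /=.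
  have -> : (fun x => x - t) @^-1` `]a, b]%classic = `]a + t, b + t]%classic :> set R.
    by apply/seteqP; split => x /=; rewrite !in_itv/= ltrBrDr lerBlDr.
  rewrite !lebesgue_measure_itv/= !lte_fin ltrD2r.
  by case: ifP => // _; rewrite -!EFinB opprD addrACA subrr addr0.
by [].
Qed.

Lemma periodicz (R : realType) (f : R -> R) (p : R) :
  (forall x, f (x + p) = f x) -> forall (m : int) x, f (x + p * m%:~R) = f x.
Proof.
move=> fp m x.
have fn (n : nat) y : f (y + p * n%:R) = f y.
  elim: n y => [|n IH] y; first by rewrite mulr0 addr0.
  by rewrite -natr1 mulrDr mulr1 addrA fp IH.
case: m => n; first exact: fn.
by rewrite NegzE -(fn n.+1) mulrNz mulrN subrK.
Qed.

Section Drift.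
Variables (R : realType) (V : R -> R) (p s c : R).
Hypotheses (mV : measurable_fun [set: R] V) (p_gt0 : 0 < p) (c_neq0 : c != 0).
Hypotheses (Vp : forall x, V (x + p) = V x) (Vs : forall x, V (x + s) = V x + c).
Local Notation mu := (@lebesgue_measure R).

Lemma drift_shiftn (n : nat) x : V (x + s * n%:R) = V x + c * n%:R.
Proof.
elim: n x => [|n IH] x; first by rewrite !mulr0 !addr0.
by rewrite -natr1 !mulrDr !mulr1 !addrA Vs IH.
Qed.

(** Reducing a multiple of [s] modulo the period gives, for each [n], a shift by
    less than [p] that raises [V] by [c * n]. *)
Lemma drift_frac (n : nat) :
  exists2 t, 0 <= t < p & forall x, V (x + t) = V x + c * n%:R.
Proof.
pose m := Num.floor (s * n%:R / p).
exists (s * n%:R - p * m%:~R).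
  have := floor_itv (s * n%:R / p); rewrite -/m.
  rewrite ler_pdivlMr// ltr_pdivrMr// intrD mulrDl mul1r => /andP[h1 h2].
  by rewrite subr_ge0 (mulrC p) h1/= ltrBlDr addrC.
move=> x; rewrite -(periodicz Vp m) addrA subrK.
exact: drift_shiftn.
Qed.

Lemma drift_bounded_measurable (M : R) :
  measurable ([set x | `|V x| <= M] `&` `[0, p[).
Proof.
apply: measurableI; last exact: measurable_itv.
rewrite -[X in measurable X]setTI.
suff -> : [set x | `|V x| <= M] = V @^-1` `[- M, M].
  by apply: mV => //; exact: measurable_itv.
by apply/seteqP; split => x /=; rewrite in_itv/= ler_norml.
Qed.

(** The set [A] where [V] is bounded by [M] has infinitely many translates by
    vectors of [[0, p[] on which the values of [V] are pairwise disjoint.  They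
    are disjoint sets of the same measure inside [[0, 2 p[]. *)
Lemma drift_bounded_null (M : R) :
  mu ([set x | `|V x| <= M] `&` `[0, p[) = 0%E.
Proof.
set A := _ `&` _.
have mA : measurable A by exact: drift_bounded_measurable.
(* [V] varies by at most [2 * M] on [A], so shifts that raise it by multiples of
   [c * K] move [A] off itself. *)
have [K KM] : exists K : nat, 2 * M < `|c| * K%:R.
  exists (Num.bound `|2 * M / `|c| |); rewrite [X in _ < X]mulrC -ltr_pdivrMr ?normr_gt0//.
  by rewrite (le_lt_trans (ler_norm _))// archi_boundP.
pose t n := sval (cid2 (drift_frac (n * K))).
have tP n : 0 <= t n < p by rewrite /t; case: cid2.
have Vt n x : V (x + t n) = V x + c * (n * K)%:R by rewrite /t; case: cid2.
pose B n := (fun x => x - t n) @^-1` A.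
have mB n : measurable (B n).
  rewrite -[X in measurable X]setTI.
  by apply: (_ : measurable_fun [set: R] (fun x => x - t n)) => //; exact: measurable_funB.
have BV n x : B n x -> `|V x - c * (n * K)%:R| <= M.
  by move=> [/= + _]; rewrite -{2}(subrK (t n) x) Vt addrK.
have Bdisj n m x : (n < m)%N -> B n x -> B m x -> False.
  move=> nm /BV Bn /BV Bm.
  have : `|c| * (m * K - n * K)%:R <= 2 * M.
    rewrite -[(_ - _)%:R]ger0_norm// -normrM natrB ?leq_mul2r ?(ltnW nm) ?orbT//.
    have -> : c * ((m * K)%:R - (n * K)%:R) =
      (V x - c * (n * K)%:R) - (V x - c * (m * K)%:R) by ring.
    by rewrite (le_trans (ler_normB _ _))// mulr2n mulrDl mul1r lerD.
  apply/negP; rewrite -ltNge (lt_le_trans KM)// ler_wpM2l// ler_nat.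
  by rewrite -mulnBl leq_pmull// subn_gt0.
have tB (D : set nat) : trivIset D B.
  move=> n m _ _ [x [Bn Bm]].
  by case: (ltngtP n m) => // nm; exfalso; [apply: (Bdisj n m x)|apply: (Bdisj m n x)].
have muB n : mu (B n) = mu A by exact: lebesgue_measure_translate.
have Afin : mu A = (fine (mu A))%:E.
  rewrite fineK// ge0_fin_numE//.
  apply: (@le_lt_trans _ _ (mu `[0, p[)).
    by apply: le_measure; rewrite ?inE//; exact: subIsetr.
  by rewrite lebesgue_measure_itv/=; case: ifP => _; rewrite ?ltry ?lt0y.
have le2p N : fine (mu A) * N%:R <= 2 * p.
  have <- : \sum_(i < N) fine (mu A) = fine (mu A) * N%:R.
    by rewrite sumr_const card_ord mulr_natr.
  rewrite -lee_fin -sumEFin (eq_bigr (fun i : 'I_N => mu (B i))) => [|i _]; last first.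
    by rewrite muB Afin.
  rewrite -measure_bigsetU//.
  have -> : (2 * p)%:E = mu `[0, 2 * p].
    by rewrite lebesgue_measure_itv/= lte_fin mulr_gt0// sube0.
  apply: le_measure; rewrite ?inE//.
    by apply: bigsetU_measurable => i _; exact: mB.
  rewrite -bigcup_mkord => x [n _ [_ /=]]; rewrite !in_itv/=.
  have /andP[t0 tp] := tP n.
  by move=> /andP[x0 xp]; apply/andP; split; lra.
have a_ge0 : 0 <= fine (mu A) by rewrite fine_ge0.
rewrite Afin; congr (_%:E); apply/eqP; rewrite eq_le a_ge0 andbT leNgt.
apply/negP => a_gt0.
have := le2p (Num.bound `|2 * p / fine (mu A)|).
rewrite [_ * _%:R]mulrC -ler_pdivlMr// leNgt => /negP; apply.
by rewrite (le_lt_trans (ler_norm _))// archi_boundP.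
Qed.

(** The circle is the union over [n] of the null sets where [V] is bounded by [n]. *)
Lemma no_measurable_drift : False.
Proof.
have : mu `[0, p[ = 0%E.
  apply: measure_negligible => //.
  have -> : `[0, p[%classic = \bigcup_(n : nat) ([set x | `|V x| <= n%:R] `&` `[0, p[).
    apply/seteqP; split => [x xp|x [n _ []]//].
    by exists (Num.bound `|V x|) => //; split => //=; rewrite ltW// archi_boundP.
  apply: negligible_bigcup => n.
  by apply/negligibleP; [exact: drift_bounded_measurable|exact: drift_bounded_null].
by rewrite lebesgue_measure_itv/= lte_fin p_gt0 sube0 => -[] /eqP; rewrite gt_eqF.
Qed.
End Drift.

(** * The topology of the complex plane *)

Section ComplexPlane.
Variable R : realType.
Local Notation C := R[i]%C.
Implicit Types (z w : C).

Lemma normc_complexE z : `|z| = (ComplexField.Normc.normc z)%:C%C.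
Proof. by []. Qed.

(** The modulus of [R[i]] takes its values in [R[i]]; with the real-valued [normc]
    the neighbourhoods of the plane are compared with those of real spaces. *)
Lemma continuous_complex_lipschitz (T : pseudoMetricNormedZmodType R) (h : C -> T) :
  (forall z w, `|h z - h w| <= ComplexField.Normc.normc (z - w)) -> continuous h.
Proof.
move=> hL z; apply/(@cvgrPdist_lt _ T _ (nbhs z) _ h) => e e0; near=> w.
rewrite (le_lt_trans (hL _ _))// -ltcR -normc_complexE.
suff : ball z e%:C%C w by rewrite -ball_normE.
by near: w; apply: nbhsx_ballx; rewrite ltcR.
Unshelve. all: by end_near. Qed.

Lemma Re_continuous : continuous (@complex.Re R : C -> R).
Proof.
apply: continuous_complex_lipschitz => z w.
have := normc_ge_Re (z - w); rewrite normc_complexE lecR.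
by rewrite raddfB.
Qed.

Lemma le_Im_normc z w : `|complex.Im z - complex.Im w| <= ComplexField.Normc.normc (z - w).
Proof.
rewrite -raddfB; case: (z - w) => a b /=.
by rewrite -sqrtr_sqr ler_wsqrtr// lerDr sqr_ge0.
Qed.

Lemma Im_continuous : continuous (@complex.Im R : C -> R).
Proof. by apply: continuous_complex_lipschitz; exact: le_Im_normc. Qed.

Lemma normc_le_ReIm z : ComplexField.Normc.normc z <= `|complex.Re z| + `|complex.Im z|.
Proof.
case: z => a b /=.
rewrite -[leRHS]ger0_norm ?addr_ge0// -sqrtr_sqr ler_wsqrtr//.
rewrite sqrrD !real_normK ?num_real// addrAC lerDl.
by rewrite mulrn_wge0// mulr_ge0.
Qed.

Lemma continuous_complexP (T : topologicalType) (h : T -> C) :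
  continuous (fun t => complex.Re (h t)) -> continuous (fun t => complex.Im (h t)) ->
  continuous h.
Proof.
move=> cr ci t; apply/(@cvgrPdist_lt _ C _ (nbhs t) _ h) => e e_gt0.
have [eE e0] : e = (complex.Re e)%:C%C /\ 0 < complex.Re e / 2.
  move: e_gt0; rewrite ltcE/= => /andP[/eqP e0 ?]; split; last by rewrite divr_gt0.
  by case: (e) e0 => a b /= ->.
have /(@cvgrPdist_lt _ R _ (nbhs t) _ (fun t => complex.Re (h t)))/(_ _ e0) := cr t.
have /(@cvgrPdist_lt _ R _ (nbhs t) _ (fun t => complex.Im (h t)))/(_ _ e0) := ci t.
apply: filterS2 => s hi hr.
rewrite eE normc_complexE ltcR (le_lt_trans (normc_le_ReIm _))//.
by rewrite !raddfB/= (splitr (complex.Re e)) ltrD.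
Qed.
End ComplexPlane.

(** * Derivatives along horizontal and vertical lines *)

Section Along.
Variable R : realType.
Local Notation C := R[i]%C.
Implicit Types (f : C -> C) (z : C) (b : bool).

Lemma is_derive_shift0 (h : R -> R) (t : R) :
  derivable (fun s => h (s + t)) 0 1 ->
  is_derive t 1 h (derive1 (fun s => h (s + t)) 0).
Proof.
move=> dh.
rewrite [X in is_derive _ _ X](_ : h = (fun s => h (s + t)) \o (fun s => s - t)); last
  by apply: funext => s /=; rewrite subrK.
rewrite -[derive1 _ _]mulr1; apply: is_derive1_comp.
  rewrite subrr derive1E; exact/derivableP.
exact: is_derive_shift.
Qed.

Lemma re_along_shift b f z (t s : R) :
  re_along b f z (s + t) = re_along b f (z + t%:C%C * dir R b) s.
Proof.
by rewrite /re_along; congr (complex.Re (f _)); rewrite rmorphD/= mulrDl addrCA addrC addrAC -addrA.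
Qed.

Lemma im_along_shift b f z (t s : R) :
  im_along b f z (s + t) = im_along b f (z + t%:C%C * dir R b) s.
Proof.
by rewrite /im_along; congr (complex.Im (f _)); rewrite rmorphD/= mulrDl addrCA addrC addrAC -addrA.
Qed.

Lemma is_derive_re_along b f z (t : R) : has_partial b f (z + t%:C%C * dir R b) ->
  is_derive t 1 (re_along b f z) (complex.Re (partial b f (z + t%:C%C * dir R b))).
Proof.
move=> [dr _]; rewrite /partial/=.
have -> : re_along b f (z + t%:C%C * dir R b) = (fun s => re_along b f z (s + t)).
  by apply: funext => s; rewrite re_along_shift.
apply: is_derive_shift0.
by under eq_fun do rewrite re_along_shift.
Qed.

Lemma is_derive_im_along b f z (t : R) : has_partial b f (z + t%:C%C * dir R b) ->
  is_derive t 1 (im_along b f z) (complex.Im (partial b f (z + t%:C%C * dir R b))).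
Proof.
move=> [_ di]; rewrite /partial/=.
have -> : im_along b f (z + t%:C%C * dir R b) = (fun s => im_along b f z (s + t)).
  by apply: funext => s; rewrite im_along_shift.
apply: is_derive_shift0.
by under eq_fun do rewrite im_along_shift.
Qed.

Lemma is_derive_Re_dx f (x y : R) : has_partial false f (x +i* y)%C ->
  is_derive x 1 (fun s => complex.Re (f (s +i* y)%C)) (complex.Re (partial false f (x +i* y)%C)).
Proof.
have E s : ((0 +i* y) + s%:C * dir R false = s +i* y)%C.
  by rewrite /dir mulr1; apply/eqP; rewrite eq_complex/= add0r addr0 !eqxx.
move=> pf; have := @is_derive_re_along false f (0 +i* y)%C x.
rewrite E => /(_ pf); congr is_derive.
by apply: funext => s; rewrite /re_along E.
Qed.

Lemma is_derive_Im_dy f (x y : R) : has_partial true f (x +i* y)%C ->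
  is_derive y 1 (fun s => complex.Im (f (x +i* s)%C)) (complex.Im (partial true f (x +i* y)%C)).
Proof.
have E s : (x%:C + s%:C * dir R true = x +i* s)%C.
  by rewrite /dir; apply/eqP; rewrite eq_complex/= !(mul0r,mulr0,mulr1,add0r,addr0,subr0) !eqxx.
move=> pf; have := @is_derive_im_along true f x%:C%C y.
rewrite E => /(_ pf); congr is_derive.
by apply: funext => s; rewrite /im_along E.
Qed.

(** The real part of the equation that defines [dbar]: up to the term in [dbar f],
    one of the two Cauchy-Riemann equations. *)
Lemma dbar_Re f z : complex.Im (partial true f z) =
  complex.Re (partial false f z) - 2 * complex.Re (dbar f z).
Proof.
rewrite /dbar; case: (partial false f z) (partial true f z) => a b [c d] /=.
by field.
Qed.
End Along.

(** * Averages over a horizontal period *)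

Section Average.
Variable R : realType.
Local Notation C := R[i]%C.
Local Notation mu := (@lebesgue_measure R).

Lemma continuous_horizontal (y : R) : continuous (fun x : R => (x +i* y)%C : C).
Proof.
apply: continuous_complexP => x /=; [exact: cvg_id|exact: cvg_cst].
Qed.

Lemma continuous_cart : continuous (fun p : R * R => (p.1 +i* p.2)%C : C).
Proof.
apply: continuous_complexP => p /=; [exact: cvg_fst|exact: cvg_snd].
Qed.

Lemma bounded_on_rectangle (h : C -> R) (a b c d : R) : continuous h ->
  exists M, forall x y, x \in `[a, b] -> y \in `[c, d] -> `|h (x +i* y)%C| <= M.
Proof.
move=> ch.
have : compact ((fun p : R * R => h (p.1 +i* p.2)%C) @` (`[a, b] `*` `[c, d])).
  apply: continuous_compact; last by apply: compact_setX; exact: segment_compact.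
  apply: continuous_subspaceT => p.
  exact: (continuous_comp (@continuous_cart p) (ch _)).
move=> /compact_bounded [M [_ HM]]; exists (M + 1) => x y xab ycd.
by apply: (HM (M + 1)); rewrite ?ltrDl//; exists (x, y).
Qed.

Lemma continuous_integrable_itv (h : R -> R) (a b : R) : continuous h ->
  mu.-integrable `[a, b] (EFin \o h).
Proof.
move=> ch; apply: continuous_compact_integrable; first exact: segment_compact.
exact: continuous_subspaceT.
Qed.

(** The imaginary part of the zero Fourier mode, not divided by the period. *)
Definition average (T : R) (f : C -> C) (y : R) : R :=
  \int[mu]_(x in `[0, T]) complex.Im (f (x +i* y)%C).

Lemma integral_derivative_periodic (u u' : R -> R) (T : R) : 0 < T ->
  (forall x : R, is_derive x (1 : R) u (u' x)) -> continuous u' -> u T = u 0 ->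
  \int[mu]_(x in `[0, T]) u' x = 0.
Proof.
move=> T0 du cu' uT; rewrite /Rintegral.
rewrite (@continuous_FTC2 _ u' u 0 T)//= ?uT ?subrr//.
- exact: continuous_subspaceT.
- have cu : continuous u by move=> x; apply: differentiable_continuous; apply/derivable1_diffP; case: (du x).
  split => //.
  + by apply: cvg_at_right_filter; exact: cu.
  + by apply: cvg_at_left_filter; exact: cu.
- by move=> x _; rewrite derive1E; case: (du x).
Qed.

Variables (f : C -> C) (T : R).
Hypotheses (sf : smooth f) (T_gt0 : 0 < T).
Hypothesis fT : forall y, f (T +i* y)%C = f (0 +i* y)%C.

Lemma continuous_partial b : continuous (partial b f).
Proof. by case: (sf [:: b]). Qed.

Lemma smooth_has_partial b z : has_partial b f z.
Proof. by case: (sf [::]) => _; apply. Qed.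

(** Differentiation under the integral sign turns the derivative of the average
    into the integral of [v_y = u_x - 2 Re (dbar f)], where [u] and [v] are the
    real and imaginary parts of [f], and [u_x] integrates to zero over a period.
    The average thus depends on [f] only through [dbar f], up to a constant. *)
Lemma is_derive_average (y : R) : is_derive y 1 (average T f)
  (- 2 * \int[mu]_(x in `[0, T]) complex.Re (dbar f (x +i* y)%C)).
Proof.
pose F (y x : R) : R := complex.Im (f (x +i* y)%C).
have d1F (x z : R) : is_derive z (1 : R) (F ^~ x) (complex.Im (partial true f (x +i* z)%C)).
  exact/is_derive_Im_dy/smooth_has_partial.
have cIm : continuous (fun z : C => complex.Im (partial true f z)).
  move=> z; exact: (continuous_comp (@continuous_partial true z) (@Im_continuous _ _)).
have cRe : continuous (fun z : C => complex.Re (partial false f z)).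
  move=> z; exact: (continuous_comp (@continuous_partial false z) (@Re_continuous _ _)).
have cImf : continuous (fun z : C => complex.Im (f z)).
  move=> z; have [cf _] := sf [::].
  exact: (continuous_comp (cf z) (@Im_continuous _ _)).
have intF z : `]y - 1, y + 1[%classic z -> mu.-integrable `[0, T] (EFin \o F z).
  move=> _; apply: continuous_integrable_itv => x.
  exact: (continuous_comp (@continuous_horizontal z x) (cImf _)).
have [M HM] := @bounded_on_rectangle _ 0 T (y - 1) (y + 1) cIm.
have yI : `]y - 1, y + 1[%classic y by rewrite /= in_itv/= ltrBlDr ltrDl ltr01.
have M0 : 0 <= M.
  apply: (le_trans (normr_ge0 _) (HM 0 y _ _)); rewrite in_itv/=.
    by rewrite lexx ltW.
  by apply/andP; split; lra.
have dF z x : `]y - 1, y + 1[%classic z -> `[0, T]%classic x -> derivable (F ^~ x) z 1.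
  by move=> _ _; case: (d1F x z).
have p1F z x : partial1of2 F z x = complex.Im (partial true f (x +i* z)%C).
  by rewrite partial1of2E; case: (d1F x z).
have iM : mu.-integrable `[0, T] (EFin \o cst M).
  by apply: continuous_integrable_itv => x; exact: cvg_cst.
have bF z x : `]y - 1, y + 1[%classic z -> `[0, T]%classic x -> `|partial1of2 F z x| <= cst M x.
  move=> zy xT; rewrite p1F; apply: HM => //.
  by move: zy => /=; rewrite !in_itv/= => /andP[/ltW -> /ltW ->].
have mT : measurable (`[0, T]%classic : set (measurableTypeR R)) by [].
have dA := @derivable_under_integral R _ _ mu F _ mT y _ _ yI intF dF (cst M) (fun=> M0) iM bF.
have eA := @differentiation_under_integral R _ _ mu F _ mT y _ _ yI intF dF (cst M) (fun=> M0) iM bF.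
apply: (is_derive_eq (DeriveDef dA (erefl _))).
rewrite -derive1E eA.
under eq_Rintegral do rewrite p1F dbar_Re.
have cdbar : continuous (fun z : C => complex.Re (dbar f z)).
  have -> : (fun z : C => complex.Re (dbar f z)) = fun z : C =>
      2^-1 * (complex.Re (partial false f z) - complex.Im (partial true f z)).
    by apply: funext => z; rewrite dbar_Re; field.
  move=> z; apply: (@cvgMl_tmp _ _ (nbhs z)); apply: (@cvgB _ _ _ (nbhs z)).
    exact: cRe.
  exact: cIm.
have ch (h : C -> R) : continuous h -> continuous (fun x : R => h (x +i* y)%C).
  by move=> ch x; exact: (continuous_comp (@continuous_horizontal y x) (ch _)).
have int_dbar : mu.-integrable `[0, T] (EFin \o fun x => complex.Re (dbar f (x +i* y)%C)).
  by apply: continuous_integrable_itv; exact: (ch _ cdbar).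
rewrite RintegralB//; last 2 first.
  by apply: continuous_integrable_itv; exact: (ch _ cRe).
  apply: continuous_integrable_itv => x; apply: (@cvgMl_tmp _ _ (nbhs x)); exact: (ch _ cdbar).
rewrite RintegralZl// mulNr -[RHS]add0r; congr (_ - _).
apply: (@integral_derivative_periodic (fun x => complex.Re (f (x +i* y)%C))) => //.
- by move=> x; exact/is_derive_Re_dx/smooth_has_partial.
- exact: (ch _ cRe).
- by rewrite fT.
Qed.
End Average.

(** * Continuity into and out of the space of smooth functions *)

Section CinfTopology.
Variable R : realType.
Local Notation C := R[i]%C.
Local Notation normc := (@ComplexField.Normc.normc R).

Lemma ball_normc (z w : C) (e : R) : ball z e%:C%C w <-> normc (z - w) < e.
Proof. by rewrite -ball_normE /ball_/= normc_complexE ltcR. Qed.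

Lemma near_Cinf (f : Cinf R) (s : seq bool) (K : set C) (e : R) :
  compact K -> 0 < e ->
  \forall g \near f, forall z, K z -> normc (partials s f z - partials s (g : Cinf R) z) < e.
Proof.
move=> cK e0.
have e0' : 0 < e%:C%C by rewrite ltcR.
have := @fam_nbhs C C compact K _ (partials s f) (@entourage_ball _ C (PosNum e0')) cK.
move=> /(@proj_continuous _ (fun=> {family compact, C -> C}) s (jet f)) H.
have := @initial_continuous _ _ (@jet R) f _ H.
apply: (@filterS _ (nbhs f)) => g Hg z Kz; apply/ball_normc; exact: Hg.
Qed.

(** Continuity can be tested on one partial derivative and one compact set at a
    time, since a product carries the coordinatewise topology and the topology
    of compact convergence is a supremum over the compact sets. *)
Lemma continuous_to_Cinf (T : topologicalType) (h : T -> Cinf R) :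
  (forall (t : T) (s : seq bool) (K : set C) (e : R), compact K -> 0 < e ->
     \forall u \near t, forall z, K z ->
       normc (partials s (h t) z - partials s (h u) z) < e) ->
  continuous h.
Proof.
move=> hh t.
have cj : (jet (h u)) @[u --> t] --> jet (h t).
  apply/cvg_sup => s; apply/cvg_image.
    apply/seteqP; split => // y _ /=; exists (fun=> y) => //.
  apply: (@cvg_trans _ ((partials s (h u) : {family compact, C -> C}) @[u --> t])).
    move=> A AF; exists (@proj _ (fun=> {family compact, C -> C}) s @^-1` A) => //.
    by rewrite image_preimage//; apply/seteqP; split => // y _; exists (fun=> y).
  (* Entourages of the plane come from radii in [R[i]], which are positive reals. *)
  apply/fam_cvgP => K cK A /uniform_nbhs [E [+ EA]].
  rewrite -entourage_ballE => -[e /= e0 eE].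
  have [eE' e0'] : e = (complex.Re e)%:C%C /\ 0 < complex.Re e.
    by move: e0; rewrite ltcE/= => /andP[/eqP]; case: (e) => a b /= ->.
  apply: filterS (hh t s K _ cK e0') => u Hu.
  by apply: EA => z Kz; apply: eE => /=; rewrite eE'; apply/ball_normc/Hu.
move=> A [_ [[U oU <-] Uf UA]].
apply: (@filterS _ _ _ (fun u => U (jet (h u)))) => [u|]; first exact: UA.
by apply: cj; apply: open_nbhs_nbhs.
Qed.

Lemma continuous_average (T : R) : 0 < T ->
  continuous (fun f : Cinf R => average T f 0).
Proof.
move=> T0 f; apply/(@cvgrPdist_lt _ R _ (nbhs f) _ (fun f : Cinf R => average T f 0)) => e e0.
have cK : compact ((fun x : R => (x +i* 0)%C : C) @` `[0, T]).
  apply: continuous_compact; last exact: segment_compact.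
  exact/continuous_subspaceT/continuous_horizontal.
have e'0 : 0 < e / (2 * T) by rewrite divr_gt0// mulr_gt0.
have := @near_Cinf f [::] _ _ cK e'0; apply: filterS => g fg /=.
have ck (k : Cinf R) : continuous (fun x : R => complex.Im (k (x +i* 0)%C)).
  move=> x; have [ck _] := @Cinf_smooth _ k [::].
  exact: (continuous_comp (continuous_comp (@continuous_horizontal _ 0 x) (ck _)) (@Im_continuous _ _)).
have cfg : continuous (fun x : R => complex.Im (f (x +i* 0)%C) - complex.Im (g (x +i* 0)%C)).
  move=> x; exact: (@cvgB _ _ _ (nbhs x) _ _ _ _ _ (ck f x) (ck g x)).
have cn : continuous (fun x : R => `|complex.Im (f (x +i* 0)%C) - complex.Im (g (x +i* 0)%C)|).
  move=> x; exact: (continuous_comp (cfg x) (@norm_continuous _ _ _)).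
rewrite /average -RintegralB//; try exact: continuous_integrable_itv.
apply: (le_lt_trans (le_normr_Rintegral _ _)) => //=.
  exact: continuous_integrable_itv.
apply: (@le_lt_trans _ _ (\int[@lebesgue_measure R]_(x in `[0, T]) (e / (2 * T)))).
  apply: le_Rintegral => //; try exact: continuous_integrable_itv.
    by apply: continuous_integrable_itv => x; exact: cvg_cst.
  move=> x xT; apply/ltW; apply: le_lt_trans (fg _ (ex_intro2 _ _ x xT erefl)).
  exact: le_Im_normc.
rewrite Rintegral_cst//=.
have -> : fine (@lebesgue_measure R `[0, T]) = T.
  by rewrite lebesgue_measure_itv/= lte_fin T0 sube0.
have -> : e / (2 * T) * T = e / 2 by field; rewrite gt_eqF.
by rewrite ltr_pdivrMr// ltr_pMr// ltr1n.
Qed.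
End CinfTopology.

(** * Trigonometric sums *)

Section Wave.
Variable R : realType.
Local Notation C := R[i]%C.

(** Trigonometric sums with amplitudes [a], [b], [c], [d]; the index [n] counts
    quarter turns.  As [cos' = cos (. + pi / 2)], each partial derivative advances
    [n] by one and changes the amplitudes only, so this family contains all the
    iterated partial derivatives of its members, and the parameter [th] enters
    them in the same way. *)
Definition wave (P : R * R * R * R) (th : R) (n : nat) (z : C) : C :=
  let: (a, b, c, d) := P in
  let phi := pi / 2 * n%:R in
  ((a + b * cos (complex.Re z + phi) + c * cos (pi * complex.Im z + phi))
   +i* (d * cos (complex.Im z + th + phi)))%C.

Definition wave_step (b0 : bool) (P : R * R * R * R) : R * R * R * R :=
  let: (a, b, c, d) := P in
  if b0 then (0, 0, pi * c, d) else (0, b, 0, 0).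

Lemma is_derive_cos_affine (k m r t : R) :
  is_derive t (1 : R) (fun t => k * cos (m * t + r)) (k * m * cos (m * t + r + pi / 2)).
Proof.
rewrite cosDpihalf.
have dl : is_derive t (1 : R) (fun t => m * t + r) m.
  have := is_deriveD (is_deriveZ m (is_derive_id t (1:R))) (is_derive_cst r t 1).
  by rewrite addr0 /GRing.scale/= mulr1.
have := is_deriveZ k (@is_derive1_comp _ cos _ t _ _ (is_derive_cos (m * t + r)) dl).
by move=> H; apply: is_derive_eq; rewrite /GRing.scale/=; ring.
Qed.

Lemma is_derive0_cos_affine (h : R -> R) (dh k0 k m r : R) :
  (forall t, h t = k0 + k * cos (m * t + r)) -> dh = k * m * cos (r + pi / 2) ->
  is_derive (0 : R) (1 : R) h dh.
Proof.
move=> hE ->; rewrite (_ : h = cst k0 + (fun t => k * cos (m * t + r))); last first.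
  by apply: funext => t; rewrite hE.
have := is_deriveD (is_derive_cst k0 (0:R) 1) (is_derive_cos_affine k m r 0).
by rewrite add0r mulr0 add0r.
Qed.

Lemma is_derive_wave (b0 : bool) P th n z :
  is_derive (0 : R) (1 : R) (re_along b0 (wave P th n) z)
    (complex.Re (wave (wave_step b0 P) th n.+1 z)) /\
  is_derive (0 : R) (1 : R) (im_along b0 (wave P th n) z)
    (complex.Im (wave (wave_step b0 P) th n.+1 z)).
Proof.
move: P z => [[[a b] c] d] [x y].
have phiS : pi / 2 * n.+1%:R = pi / 2 * n%:R + pi / 2 :> R.
  by rewrite -(natr1 n) mulrDr mulr1.
rewrite /wave /wave_step phiS; set phi := pi / 2 * n%:R.
case: b0; rewrite /re_along /im_along /dir/=; split.
- apply: (@is_derive0_cos_affine _ _ (a + b * cos (x + phi)) c pi (pi * y + phi)).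
    by move=> t; congr (_ + _ * cos _ + _ * cos _); ring.
  by rewrite add0r mul0r add0r addrA (mulrC c).
- apply: (@is_derive0_cos_affine _ _ 0 d 1 (y + th + phi)).
    by move=> t; rewrite add0r; congr (_ * cos _); ring.
  by rewrite mulr1 addrA.
- apply: (@is_derive0_cos_affine _ _ (a + c * cos (pi * y + phi)) b 1 (x + phi)).
    move=> t; rewrite addrAC; congr (_ + _ * cos _ + _ * cos _); ring.
  by rewrite add0r mul0r addr0 mulr1 addrA.
- apply: (@is_derive0_cos_affine _ _ (d * cos (y + th + phi)) 0 0 0).
    by move=> t; rewrite (mul0r (cos _)) addr0; congr (_ * cos _); ring.
  by rewrite !mul0r.
Qed.

Lemma partial_wave b0 P th n :
  partial b0 (wave P th n) = wave (wave_step b0 P) th n.+1.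
Proof.
apply: funext => z; have [dr di] := is_derive_wave b0 P th n z.
rewrite /partial !derive1E (@derive_val _ _ _ _ _ _ _ dr) (@derive_val _ _ _ _ _ _ _ di).
by case: (wave _ _ _ z).
Qed.

Lemma partials_wave s P th n :
  partials s (wave P th n) = wave (foldr wave_step P s) th (size s + n)%N.
Proof. by elim: s => //= b0 s ->; rewrite partial_wave. Qed.

Lemma continuous_wave P th n : continuous (wave P th n).
Proof.
move: P => [[[a b] c] d].
have cRe : continuous (fun z : C => complex.Re z) by exact: Re_continuous.
have cIm : continuous (fun z : C => complex.Im z) by exact: Im_continuous.
have ccos (h : C -> R) : continuous h -> continuous (fun z => cos (h z)).
  by move=> ch z; exact: (continuous_comp (ch z) (@continuous_cos _ _)).
have cadd (h k : C -> R) : continuous h -> continuous k -> continuous (fun z => h z + k z).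
  by move=> ch ck z; exact: (@cvgD _ _ _ (nbhs z) _ h k _ _ (ch z) (ck z)).
have ccst (k : R) : continuous (fun _ : C => k) by exact: cst_continuous.
have cmul (k : R) (h : C -> R) : continuous h -> continuous (fun z => k * h z).
  by move=> ch z; exact: (@cvgMl_tmp _ _ (nbhs z) _ h k _ (ch z)).
apply: continuous_complexP => /=; rewrite /wave/=.
  pose phi : R := pi / 2 * n%:R.
  exact: (cadd _ _
    (cadd _ _ (ccst a) (cmul b _ (ccos _ (cadd _ _ cRe (ccst phi)))))
    (cmul c _ (ccos _ (cadd _ _ (cmul pi _ cIm) (ccst phi))))).
exact: (cmul d _ (ccos _ (cadd _ _ (cadd _ _ cIm (ccst th)) (ccst (pi / 2 * n%:R))))).
Qed.

Lemma smooth_wave P th n : smooth (wave P th n).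
Proof.
move=> s; rewrite partials_wave; split; first exact: continuous_wave.
by move=> b0 z; have [[? _] [? _]] := is_derive_wave b0 (foldr wave_step P s) th (size s + n) z.
Qed.

Lemma cos_lipschitz (x y : R) : `|cos x - cos y| <= `|x - y|.
Proof.
wlog xy : x y / x <= y.
  by move=> H; case: (leP x y) => [/H//|/ltW/H]; rewrite distrC (distrC y).
rewrite distrC (distrC x).
have [t _ ->] := @MVT_segment _ cos (fun t => - sin t) _ _ xy
  (fun t _ => is_derive_cos t) (continuous_subspaceT (@continuous_cos R)).
by rewrite normrM normrN ler_piMl// sin_max.
Qed.

Lemma wave_lipschitz P th th' n z :
  ComplexField.Normc.normc (wave P th n z - wave P th' n z) <= `|P.2| * `|th - th'|.
Proof.
move: P z => [[[a b] c] d] [x y]; apply: (le_trans (normc_le_ReIm _)) => /=.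
rewrite subrr normr0 add0r -mulrBr normrM ler_wpM2l//.
by rewrite (le_trans (cos_lipschitz _ _))// opprD addrACA subrr addr0 opprD addrACA subrr add0r.
Qed.
End Wave.

(** * Functions with a one-dimensional discrete stabilizer *)

Section Witness.
Variable R : realType.
Local Notation C := R[i]%C.
Local Notation T := (pi *+ 2 : R).

Lemma cos_eq1 (t : R) : cos t = 1 -> exists m : int, t = T * m%:~R.
Proof.
have T0 : 0 < T by rewrite mulrn_wgt0// pi_gt0.
pose m := Num.floor (t / T); pose r := t - T * m%:~R.
have tE : t = r + T * m%:~R by rewrite subrK.
have /andP[r0 rT] : 0 <= r < T.
  have := floor_itv (t / T); rewrite -/m.
  rewrite ler_pdivlMr// ltr_pdivrMr// intrD mulrDl mul1r => /andP[h1 h2].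
  by rewrite subr_ge0 (mulrC T) h1/= ltrBlDr addrC (mulrC T).
rewrite tE (periodicz (@cosD2pi R)) => c1.
have [rpi|pir] := leP r pi.
  exists m; rewrite (_ : r = 0) ?add0r//.
  by apply: cos_inj; rewrite ?cos0// in_itv/= ?lexx ?r0 ?pi_ge0.
exfalso; have : T - r = 0.
  apply: cos_inj; rewrite ?in_itv/= ?lexx ?pi_ge0//.
    by apply/andP; split; [rewrite subr_ge0 ltW|rewrite mulr2n; lra].
  by rewrite cos0 -cosN opprB cosB cos2pi sin2pi mulr0 mulr1 addr0.
by move=> /eqP; rewrite subr_eq0 gt_eqF.
Qed.

(** The function [3 + cos x + cos (pi y) + i cos (y + th)]. *)
Definition witness_fun (th : R) : C -> C := wave (3, 1, 1, 1) th 0.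

Lemma witness_funE th (x y : R) :
  witness_fun th (x +i* y)%C = ((3 + cos x + cos (pi * y)) +i* cos (y + th))%C.
Proof. by rewrite /witness_fun/= !mul1r mulr0 !addr0. Qed.

Definition witness (th : R) : Cinf R := MkCinf (@smooth_wave R (3, 1, 1, 1) th 0).

Lemma witness_periodic th : witness (th + T) = witness th.
Proof.
apply: Cinf_eqP; apply: funext => -[x y].
by rewrite -[LHS]/(witness_fun _ _) -[RHS]/(witness_fun _ _) !witness_funE addrA cosD2pi.
Qed.

(** The translation vector [2 i] is a period of the real part, and it shifts the
    phase of the imaginary part. *)
Lemma translate_witness th : translate (0 +i* 2)%C (witness th) = witness (th + 2).
Proof.
apply: Cinf_eqP; apply: funext => -[x y].
change (witness_fun th ((x + 0) +i* (y + 2))%C = witness_fun (th + 2) (x +i* y)%C).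
rewrite !witness_funE addr0.
rewrite mulrDr mulr_natr cosD2pi; congr (_ +i* cos _)%C; ring.
Qed.

Lemma pi_int_multiple (j k : int) : k%:~R = pi * j%:~R :> R -> j = 0.
Proof.
move=> e; apply/eqP/negPn/negP => j0; apply: (@pi_irrationnal R).
apply/rationalP; exists (k * sgz j), `|j|%N.
rewrite natr_absz intrM e -(mulrA pi) -intrM.
have -> : j * sgz j = `|j| by rewrite -abszE abszEsg mulrC.
by rewrite mulfK// intr_eq0 normr_eq0.
Qed.

(** Comparing values at the origin forces [cos a = cos (pi b) = 1] for a period
    [a + i b], because both cosines are maximal there; at [- i th], where the
    imaginary part is maximal, it forces [cos b = 1]. *)
Lemma stabilizer_witness th :
  stabilizer (witness th) = [set T%:C%C * m%:~R | m in @setT int].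
Proof.
have intC (m : int) : T%:C%C * m%:~R = ((T * m%:~R) +i* 0)%C :> C.
  by rewrite -[m%:~R](rmorph_int (real_complex R)) -rmorphM.
apply/seteqP; split => [[a b] | _ [m _ <-]]; rewrite /stabilizer/=.
- move=> e.
  have ev (x y : R) : witness_fun th ((x + a) +i* (y + b))%C = witness_fun th (x +i* y)%C.
    exact: (congr1 (fun f : Cinf R => f (x +i* y)%C) e).
  have := ev 0 0; have := ev 0 (- th).
  rewrite !witness_funE !add0r mulr0 cos0 addNr cos0 (addrAC (- th)) addNr add0r.
  move=> [_ cb] [cab _].
  have := cos_le1 a; have := cos_le1 (pi * b) => hb ha.
  have [m am] : exists m : int, a = T * m%:~R by apply: cos_eq1; lra.
  have [k bk] : exists k : int, pi * b = T * k%:~R by apply: cos_eq1; lra.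
  have [j bj] := cos_eq1 cb.
  have b2k : b = 2 * k%:~R.
    by apply: (mulfI (lt0r_neq0 (pi_gt0 R))); rewrite bk mulr2n; ring.
  have j0 : j = 0.
    apply: (@pi_int_multiple j k); apply: (mulfI (_ : 2 != 0 :> R)) => //.
    by rewrite -b2k bj mulr2n; ring.
  by exists m => //; rewrite intC -am bj j0 mulr0.
- apply: Cinf_eqP; apply: funext => -[x y]; rewrite intC.
  change (witness_fun th ((x + T * m%:~R) +i* (y + 0))%C = witness_fun th (x +i* y)%C).
  by rewrite !witness_funE addr0 (periodicz (@cosD2pi R)).
Qed.

Lemma one_periodic_witness th : witness th \in @one_periodic R.
Proof.
apply/mem_set; exists T%:C%C; last exact: stabilizer_witness.
by rewrite eq_complex/= negb_and mulrn_eq0/= gt_eqF// pi_gt0.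
Qed.

Definition witness1 (th : R) : Cinf1 R := exist _ (witness th) (one_periodic_witness th).

Lemma witness1_periodic th : witness1 (th + T) = witness1 th.
Proof. by apply: val_inj; exact: witness_periodic. Qed.

Lemma translate1_witness1 th : translate1 (0 +i* 2)%C (witness1 th) = witness1 (th + 2).
Proof. by apply: val_inj; exact: translate_witness. Qed.

Lemma translate1_witness1_period th : translate1 T%:C%C (witness1 th) = witness1 th.
Proof.
apply: val_inj => /=.
have : stabilizer (witness th) T%:C%C by rewrite stabilizer_witness; exists 1; rewrite ?mulr1.
by [].
Qed.

Lemma continuous_witness : continuous witness.
Proof.
apply: continuous_to_Cinf => th s K e _ e0.
rewrite /witness/=.
pose M := `|(foldr (@wave_step R) (3, 1, 1, 1) s).2| + 1.
have M0 : 0 < M by rewrite ltr_wpDl.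
have eM : 0 < e / M by rewrite divr_gt0.
have : \forall u \near th, `|th - u| < e / M.
  by apply: (@cvgr_dist_lt _ _ _ (nbhs th) _ id th (@cvg_id _ _)).
apply: filterS => u thu z _; rewrite !partials_wave.
rewrite (le_lt_trans (wave_lipschitz _ _ _ _ _))//.
apply: (@le_lt_trans _ _ (M * `|th - u|)).
  by rewrite ler_wpM2r// lerDl.
by rewrite mulrC -ltr_pdivlMr.
Qed.

Lemma continuous_witness1 : continuous witness1.
Proof.
apply/continuousP => A [B oB <-].
exact: (proj1 (continuousP _) continuous_witness B oB).
Qed.
End Witness.

(** * Borel maps *)

Lemma continuous_borel_map (S T : topologicalType) (f : S -> T) :
  continuous f -> borel_map f.
Proof.
move=> /continuousP cf; suff : <<s open >> `<=` [set A | <<s open >> (f @^-1` A)] by [].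
apply: smallest_sub.
  split => /=.
  - by rewrite preimage_set0; exact: sigma_algebra0.
  - move=> A /= sA; rewrite setTD preimage_setC -setTD; exact: sigma_algebraCD.
  - by move=> F /= sF; rewrite preimage_bigcup; exact: sigma_algebra_bigcup.
by move=> A oA /=; apply: sub_gen_smallest; exact: cf.
Qed.

Lemma borel_map_comp (S T U : topologicalType) (g : T -> U) (f : S -> T) :
  borel_map g -> borel_map f -> borel_map (g \o f).
Proof. by move=> bg bf B /bg/bf. Qed.

Lemma borel_map_measurable (R : realType) (V : R -> R) :
  borel_map V -> measurable_fun [set: R] V.
Proof.
move=> bV; apply: (measurability _ (RGenOpens.measurableE R)) => _ [_ [a [b ->]] <-].
rewrite setTI; have : <<s open >> (V @^-1` `]a, b[).
  by apply: bV; apply: sub_gen_smallest; exact: interval_open.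
apply: smallest_sub; first exact: sigma_algebra_measurable.
by move=> A; exact: open_measurable.
Qed.


(** * Drift of the average of a right inverse *)

Section AverageDrift.
Variable R : realType.
Local Notation T := (pi *+ 2 : R).

(** The constant [- 12 T] is [- 2] times the integral of the real part of the
    witness over the rectangle with sides [T] and [2]. *)
Lemma average_drift (f : Cinf R) (th : R) :
  (forall y, f (T +i* y)%C = f (0 +i* y)%C) -> dbar f = witness th :> (R[i]%C -> R[i]%C) ->
  average T f 2 = average T f 0 - 12 * T.
Proof.
move=> fT fg; have T0 : 0 < T by rewrite mulrn_wgt0// pi_gt0.
have intg (y : R) : \int[@lebesgue_measure R]_(x in `[0, T])
    complex.Re (dbar f (x +i* y)%C) = (3 + cos (pi * y)) * T.
  rewrite fg.
  have -> : (fun x : R => complex.Re (witness th (x +i* y)%C)) =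
            (fun x => (3 + cos (pi * y)) + cos x).
    apply: funext => x; rewrite -[LHS]/(complex.Re (witness_fun th (x +i* y)%C)).
    by rewrite witness_funE/= addrAC.
  rewrite RintegralD//; last 2 first.
    by apply: continuous_integrable_itv => x; exact: cvg_cst.
    by apply: continuous_integrable_itv; exact: continuous_cos.
  rewrite Rintegral_cst//= lebesgue_measure_itv/= lte_fin T0 sube0/=.
  rewrite (@integral_derivative_periodic _ sin cos) ?addr0//.
    exact: continuous_cos.
  by rewrite sin2pi sin0.
(* Twice a primitive of [(3 + cos (pi * y)) * T], with the sine written as a
   shifted cosine. *)
pose c : R := 2 * T / pi.
have cpi : c * pi = 2 * T by rewrite divfK// gt_eqF ?pi_gt0.
pose P : R -> R := (6 * T) \*: id + (fun y => c * cos (pi * y + - (pi / 2))).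
have dAP (y : R) : is_derive y (1 : R) (average T f + P) 0.
  have dA := @is_derive_average _ f T (@Cinf_smooth _ f) T0 fT y.
  have dP := is_deriveD (is_deriveZ (6 * T) (is_derive_id y (1 : R)))
    (is_derive_cos_affine c pi (- (pi / 2)) y).
  apply: (is_derive_eq (is_deriveD dA dP)).
  rewrite intg subrK cpi /GRing.scale/=; ring.
have := @is_derive_0_is_cst _ _ 2 0 dAP.
rewrite /P /= -[LHS]/(average T f 2 + (6 * T * 2 + c * cos (pi * 2 - pi / 2))).
rewrite -[RHS]/(average T f 0 + (6 * T * 0 + c * cos (pi * 0 - pi / 2))).
have -> : cos (pi * 2 - pi / 2) = cos (pi * 0 - pi / 2) :> R.
  by rewrite mulr0 mulr_natr addrC cosD2pi add0r.
by move=> h; lra.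
Qed.
End AverageDrift.

Theorem theorem7p14 (R : realType) :
  ~ exists Psi : Cinf1 R -> Cinf R,
      [/\ borel_map Psi,
          forall (w : R[i]%C) (g : Cinf1 R),
            Psi (translate1 w g) = translate w (Psi g)
        & forall g : Cinf1 R,
            dbar (Psi g) = (\val g : Cinf R) :> (R[i]%C -> R[i]%C)].
Proof.
move=> [Psi [bPsi ePsi dPsi]].
have T0 : 0 < pi *+ 2 :> R by rewrite mulrn_wgt0// pi_gt0.
pose V (th : R) : R := average (pi *+ 2) (Psi (witness1 th)) 0.
have mV : measurable_fun [set: R] V.
  apply: borel_map_measurable.
  apply: (@borel_map_comp _ _ _ (fun f : Cinf R => average (pi *+ 2) f 0)).
    exact: (continuous_borel_map (continuous_average T0)).
  exact: (borel_map_comp bPsi (continuous_borel_map (@continuous_witness1 R))).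
apply: (@no_measurable_drift R V (pi *+ 2) 2 (- (12 * (pi *+ 2)))) => //.
- by rewrite oppr_eq0 mulf_neq0// gt_eqF.
- by move=> th; rewrite /V witness1_periodic.
move=> th; rewrite /V -translate1_witness1 ePsi.
rewrite -(@average_drift R (Psi (witness1 th)) th); last exact: dPsi.
  apply: eq_Rintegral => x _; congr (complex.Im (Psi _ _)).
  by apply/eqP; rewrite eq_complex/= addr0 add0r !eqxx.
move=> y; have := ePsi (pi *+ 2)%:C%C (witness1 th).
rewrite translate1_witness1_period => /(congr1 (fun f : Cinf R => f (0 +i* y)%C)) ->.
by congr (Psi _ _); apply/eqP; rewrite eq_complex/= addr0 add0r !eqxx.
Qed.
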